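(* Let $A$ be an idiom and $\mathcal{J}$ a family of nuclei on $A$. Then the supremum of $\mathcal{J}$ in $N(A)$ is \[\bigvee\mathcal{J}=\bigwedge\{\chi(a,1)\mid [a,1]\in\mathscr{F}_{\dot{\bigvee}\mathcal{J}}\}.\]
   Context: An idiom is a complete lattice $A$ (least element $0$, greatest element $1$) that is modular, i.e. $a\le b$ implies $(a\vee c)\wedge b=a\vee(c\wedge b)$, and upper continuous, i.e. $a\wedge\bigvee X=\bigvee\{a\wedge x\mid x\in X\}$ for all $a\in A$ and all directed $X\subseteq A$. For $a\le b$ in $A$, $[a,b]=\{x\in A\mid a\le x\le b\}$ is an interval. A nucleus on $A$ is a monotone map $j:A\to A$ with $a\le j(a)$, $j(a\wedge b)\ge j(a)\wedge j(b)$ and $j\circ j=j$. $N(A)$ is the set of all nuclei ordered pointwise; it is a complete lattice (in fact a frame) in which infima are computed pointwise. For each interval $[a,b]$ there is a largest nucleus $\chi(a,b)$ on $A$ such that $\chi(a,b)(a)\wedge b=a$. $\dot{\bigvee}\mathcal{J}:A\to A$ denotes the pointwise supremum, $(\dot{\bigvee}\mathcal{J})(a)=\bigvee\{j(a)\mid j\in\mathcal{J}\}$. For a map $k:A\to A$, $\mathscr{F}_k=\{[a,b]\mid k\le\chi(a,b)\}$, where $\le$ is the pointwise order. *)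

(* Defs.v *)
From HB Require Import structures.
From mathcomp Require Import all_boot all_order.
From mathcomp Require Import boolp classical_sets.

Set Implicit Arguments.
Unset Strict Implicit.
Unset Printing Implicit Defensive.

Import Order.TTheory.

(* order_scope comes last: `&` and `|` are lattice operations here. *)
Local Open Scope classical_set_scope.
Local Open Scope order_scope.

HB.mixin Record TBLattice_isComplete (d : Order.disp_t) (A : Type)
    of Order.TBLattice d A := {
  Sup : set A -> A;
  Sup_supremums : forall X : set A, supremums X (Sup X)
}.

#[short(type="completeLatticeType")]
HB.structure Definition CompleteLattice (d : Order.disp_t) :=
  { A of Order.TBLattice d A & TBLattice_isComplete d A }.

Definition Inf (d : Order.disp_t) (A : completeLatticeType d) (X : set A) : A :=
  Sup (lbound X).

Definition directed (d : Order.disp_t) (A : porderType d) (X : set A) : Prop :=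
  X !=set0 /\
  forall x y, X x -> X y -> exists z, [/\ X z, x <= z & y <= z].

HB.mixin Record CompleteLattice_isIdiom (d : Order.disp_t) (A : Type)
    of CompleteLattice d A := {
  modular_law : forall a b c : A,
    a <= b -> (a `|` c) `&` b = a `|` (c `&` b);
  upper_continuous : forall (a : A) (X : set A),
    directed X -> a `&` Sup X = Sup [set a `&` x | x in X]
}.

#[short(type="idiomType")]
HB.structure Definition Idiom (d : Order.disp_t) :=
  { A of CompleteLattice d A & CompleteLattice_isIdiom d A }.

Section CompleteLatticeTheory.
Variables (d : Order.disp_t) (A : completeLatticeType d).
Implicit Types (X : set A) (x y : A).

Lemma Sup_ub X x : X x -> x <= Sup X.
Proof. exact: (Sup_supremums X).1. Qed.

Lemma Sup_le X y : ubound X y -> Sup X <= y.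
Proof. exact: (Sup_supremums X).2. Qed.

Lemma Inf_infimums X : infimums X (Inf X).
Proof.
by split=> [x Xx|y yX]; [apply: Sup_le => y; exact|exact: Sup_ub].
Qed.

Lemma Inf_lb X x : X x -> Inf X <= x.
Proof. exact: (Inf_infimums X).1. Qed.

Lemma le_Inf X y : lbound X y -> y <= Inf X.
Proof. exact: (Inf_infimums X).2. Qed.

End CompleteLatticeTheory.

Definition is_nucleus (d : Order.disp_t) (A : latticeType d) (j : A -> A) :
    Prop :=
  [/\ {homo j : a b / a <= b},
      forall a, a <= j a,
      forall a b, j a `&` j b <= j (a `&` b)
    & forall a, j (j a) = j a].

(* [nucleus A] is N(A); as a subtype of [A -> A] it inherits the pointwise
   order of boolp. *)
Record nucleus (d : Order.disp_t) (A : latticeType d) := Nucleus {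
  nucleus_fun :> A -> A;
  nucleusb : `[< is_nucleus nucleus_fun >]
}.

HB.instance Definition _ (d : Order.disp_t) (A : latticeType d) :=
  [isSub for @nucleus_fun d A].
HB.instance Definition _ (d : Order.disp_t) (A : latticeType d) :=
  [Choice of nucleus A by <:].
HB.instance Definition _ (d : Order.disp_t) (A : latticeType d) :=
  [SubChoice_isSubPOrder of nucleus A by <: with FunOrder.fun_display].

Section NucleusOrder.
Variables (d : Order.disp_t) (A : latticeType d).
Implicit Types j k : nucleus A.

Lemma nucleusP j : is_nucleus j.
Proof. exact/asboolP/nucleusb. Qed.

Lemma nucleus_homo j : {homo j : a b / a <= b}.
Proof. by case: (nucleusP j). Qed.

Lemma nucleus_ge j a : a <= j a.
Proof. by case: (nucleusP j). Qed.

Lemma nucleus_meet j a b : j a `&` j b <= j (a `&` b).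
Proof. by case: (nucleusP j). Qed.

Lemma nucleus_idem j a : j (j a) = j a.
Proof. by case: (nucleusP j). Qed.

Lemma le_nucleusP j k : reflect (forall a, j a <= k a) (j <= k).
Proof. by rewrite leEsub; exact: lefP. Qed.

End NucleusOrder.

(* N(A) is a complete lattice: all the operations are obtained from the
   pointwise infimum of an arbitrary set of nuclei. *)
Section NucleusComplete.
Variables (d : Order.disp_t) (A : completeLatticeType d).
Implicit Types (j k : nucleus A) (J : set (nucleus A)).

Definition pinf J (a : A) : A := Inf [set j a | j in J].

Lemma pinf_is_nucleus J : is_nucleus (pinf J).
Proof.
have homo : {homo pinf J : a b / a <= b}.
  move=> a b ab; apply: le_Inf => _ [j Jj <-].
  by apply: le_trans (nucleus_homo j ab); apply: Inf_lb; exists j.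
have ge a : a <= pinf J a.
  by apply: le_Inf => _ [j Jj <-]; exact: nucleus_ge.
split=> // [a b|a].
  apply: le_Inf => _ [j Jj <-]; apply: le_trans (nucleus_meet j a b).
  by apply: leI2; apply: Inf_lb; exists j.
apply/le_anti; rewrite ge andbT; apply: le_Inf => _ [j Jj <-].
rewrite -(nucleus_idem j a); apply: (@le_trans _ _ (j (pinf J a))).
  by apply: Inf_lb; exists j.
by apply: nucleus_homo; apply: Inf_lb; exists j.
Qed.

Definition nuc_inf J : nucleus A := Nucleus (asboolT (pinf_is_nucleus J)).

Lemma nuc_inf_lb J j : J j -> nuc_inf J <= j.
Proof. by move=> Jj; apply/le_nucleusP => a; apply: Inf_lb; exists j. Qed.

Lemma le_nuc_inf J k : lbound J k -> k <= nuc_inf J.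
Proof.
move=> kJ; apply/le_nucleusP => a; apply: le_Inf => _ [j Jj <-].
by move: a; exact/le_nucleusP/kJ.
Qed.

Definition nuc_sup J : nucleus A := nuc_inf (ubound J).

Lemma nuc_sup_supremums J : supremums J (nuc_sup J).
Proof.
by split=> [j Jj|k Jk]; [apply: le_nuc_inf => k; exact|exact: nuc_inf_lb].
Qed.

Let nmeet j k := nuc_inf [set j; k].
Let njoin j k := nuc_sup [set j; k].

Let nmeetP i j k : (i <= nmeet j k) = (i <= j) && (i <= k).
Proof.
apply/idP/andP => [ijk|[ij ik]]; last by apply: le_nuc_inf => _ [->|->].
by split; apply: le_trans ijk _; apply: nuc_inf_lb; [left|right].
Qed.

Let njoinP i j k : (njoin i j <= k) = (i <= k) && (j <= k).
Proof.
apply/idP/andP => [ijk|[ik jk]]; last by apply: nuc_inf_lb => _ [->|->].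
by split; apply: le_trans ijk; apply: (nuc_sup_supremums _).1; [left|right].
Qed.

Let nbot_le k : nuc_sup set0 <= k.
Proof. by apply: nuc_inf_lb. Qed.

Let le_ntop k : k <= nuc_inf set0.
Proof. by apply: le_nuc_inf. Qed.

HB.instance Definition _ :=
  Order.POrder_MeetJoin_isLattice.Build _ (nucleus A) nmeetP njoinP.
HB.instance Definition _ := Order.hasBottom.Build _ (nucleus A) nbot_le.
HB.instance Definition _ := Order.hasTop.Build _ (nucleus A) le_ntop.
HB.instance Definition _ :=
  TBLattice_isComplete.Build _ (nucleus A) nuc_sup_supremums.

Lemma nucleus_InfE J a : Inf J a = Inf [set j a | j in J].
Proof.
suff -> : Inf J = nuc_inf J by [].
apply/le_anti/andP; split.
  by apply: le_nuc_inf => j; exact: Inf_lb.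
by apply: le_Inf => j; exact: nuc_inf_lb.
Qed.

Definition pointwise_sup J : A -> A := fun a => Sup [set j a | j in J].

End NucleusComplete.

(* The interval [lo, hi]: a nonempty interval determines its end points. *)
Record segment (d : Order.disp_t) (A : porderType d) := Segment {
  lo : A;
  hi : A;
  le_lo_hi : lo <= hi
}.

Definition upper_segment (d : Order.disp_t) (A : tbLatticeType d) (a : A) :
  segment A := Segment (lex1 a).

Section Chi.
Variables (d : Order.disp_t) (A : idiomType d).
Implicit Types (s : segment A) (j : nucleus A).

Definition collapses_trivially s : set (nucleus A) :=
  [set j | j (lo s) `&` hi s = lo s].

(* The largest element is built as the pointwise supremum of all monotone
   inflationary maps p with p a `&` p b <= p (a `&` b) and
   p (lo s) `&` hi s <= lo s; these maps are closed under composition. *)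
Lemma chi_exists s :
  exists2 j, collapses_trivially s j & ubound (collapses_trivially s) j.
Proof.
pose P := [set p : A -> A | [/\ {homo p : a b / a <= b},
  forall a, a <= p a, forall a b, p a `&` p b <= p (a `&` b)
  & p (lo s) `&` hi s <= lo s]].
have Pcomp p q : P p -> P q -> P (p \o q).
  move=> [pm pi pI ps] [qm qi qI qs]; split=> /= [a b ab|a|a b|].
  - exact/pm/qm.
  - exact: le_trans (qi a) (pi _).
  - exact: le_trans (pI _ _) (pm _ _ (qI a b)).
  - apply: le_trans ps; rewrite lexI leIr andbT.
    apply: (@le_trans _ _ (p (q (lo s)) `&` p (hi s))); first exact: leI2.
    exact: le_trans (pI _ _) (pm _ _ qs).
have Pid : P id by split=> //; exact: leIl.
pose t a := Sup [set p a | p in P].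
have tub p a : P p -> p a <= t a by move=> Pp; apply: Sup_ub; exists p.
have dir a : directed [set p a | p in P].
  split; first by exists a, id.
  move=> _ _ [p Pp <-] [q Pq <-]; exists (p (q a)).
  have [pm pi _ _] := Pp; have [_ qi _ _] := Pq.
  by split=> //; [exists (p \o q) => //; exact: Pcomp|exact: pm].
have Pt : P t.
  split=> [a b ab|a|a b|].
  - apply: Sup_le => _ [p Pp <-]; apply: le_trans (tub _ b Pp).
    by case: Pp => pm _ _ _; exact: pm.
  - exact: tub Pid.
  - rewrite upper_continuous//; apply: Sup_le => _ [_ [q Pq <-] <-].
    rewrite meetC upper_continuous//; apply: Sup_le => _ [_ [p Pp <-] <-].
    apply: le_trans (tub (p \o q) (a `&` b) (Pcomp _ _ Pp Pq)).
    have [pm pi pI _] := Pp; have [qm qi qI _] := Pq.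
    rewrite meetC; apply: le_trans (pm _ _ (qI a b)).
    by apply: le_trans (pI _ _); apply: leI2; [exact: pm|exact: pi].
  - rewrite meetC upper_continuous//.
    apply: Sup_le => _ [_ [p Pp <-] <-].
    by rewrite meetC; case: Pp.
have [tm ti tI ts] := Pt.
have tN : is_nucleus t.
  split=> // a; apply/le_anti; rewrite ti andbT.
  exact: (tub (t \o t) a (Pcomp _ _ Pt Pt)).
exists (Nucleus (asboolT tN)).
  by apply/le_anti; rewrite /= ts/= lexI ti le_lo_hi.
move=> j js; apply/le_nucleusP => a /=; apply: tub; split.
- exact: nucleus_homo.
- exact: nucleus_ge.
- exact: nucleus_meet.
- by rewrite js.
Qed.

Definition chi s : nucleus A := s2val (cid2 (chi_exists s)).

Lemma chi_lo s : chi s (lo s) `&` hi s = lo s.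
Proof. exact: s2valP (cid2 (chi_exists s)). Qed.

Lemma chi_largest s j : j (lo s) `&` hi s = lo s -> j <= chi s.
Proof. exact: (s2valP' (cid2 (chi_exists s))). Qed.

(* The set of intervals written F_k for a map k : A -> A, not necessarily a
   nucleus. *)
Definition scrF (k : A -> A) : set (segment A) :=
  [set s | k <= (chi s : A -> A)].

End Chi.

(* Main.v *)
(** Put [k := Sup J]. Each value [a := k x] is fixed by [k], so [k <= chi(a, 1)]
    by maximality of [chi(a, 1)], and [[a, 1]] belongs to the family; moreover
    [chi(a, 1) x <= chi(a, 1) a = a = k x], which bounds the infimum by [k]. *)
Require Import Defs.
From mathcomp Require Import all_boot all_order.
From mathcomp Require Import boolp classical_sets.

Import Order.TTheory.

Local Open Scope classical_set_scope.

Section ChiUpperSegment.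
Local Open Scope order_scope.
Variables (d : Order.disp_t) (A : idiomType d).
Implicit Types (J : set (nucleus A)) (j k : nucleus A) (a x : A).

(** Turns membership of [s] in [scrF (pointwise_sup J)] into [chi s] being an upper bound of [J] in
    N(A). *)
Lemma pointwise_sup_leP J k :
  reflect (ubound J k) (pointwise_sup J <= (k : A -> A)).
Proof.
apply: (iffP (lefP _ _)) => [Jk j Jj|Jk a].
  by apply/le_nucleusP => a; apply: le_trans (Jk a); apply: Sup_ub; exists j.
by apply: Sup_le => _ [j Jj <-]; move: a; exact/le_nucleusP/Jk.
Qed.

(** With upper end [1] the meet in the condition defining [chi] disappears. *)
Lemma chi_upper_fixed a : chi (upper_segment a) a = a.
Proof. by rewrite -[RHS](chi_lo (upper_segment a)) /= meetx1. Qed.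

Lemma le_chi_upper k x : k <= chi (upper_segment (k x)).
Proof. by apply: chi_largest; rewrite /= meetx1 nucleus_idem. Qed.

Lemma chi_upper_le k x : chi (upper_segment (k x)) x <= k x.
Proof.
by rewrite -[leRHS]chi_upper_fixed; apply/nucleus_homo/nucleus_ge.
Qed.

End ChiUpperSegment.

Theorem theorem3p22 (d : Order.disp_t) (A : idiomType d)
    (J : set (nucleus A)) :
  Sup J =
  Inf [set chi (upper_segment a) |
        a in [set a : A | scrF (pointwise_sup J) (upper_segment a)]].
Proof.
apply/le_anti/andP; split.
  (* Every member of the family is an upper bound of [J]. *)
  by apply: le_Inf => _ [a /pointwise_sup_leP Ja <-]; exact: Sup_le.
apply/le_nucleusP => x; apply: le_trans (chi_upper_le _ _ (Sup J) x).
(* The member chosen to bound the infimum varies with the point [x]. *)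
apply/le_nucleusP/Inf_lb; exists (Sup J x) => //.
apply/pointwise_sup_leP => j Jj.
exact: le_trans (Sup_ub Jj) (le_chi_upper _ _ _ _).
Qed.
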